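(* Let $\mathbb{K}=\mathbb{Q}[\omega]$ with $\omega$ a primitive third root of unity, let $W=\bigwedge^3_{\mathbb{K}}\mathbb{K}^6$, let $J=J_{V_+}$ be the complex structure on $\mathbb{K}^6\otimes_{\mathbb{Q}}\mathbb{R}=\mathbb{C}^6$ attached to a 3-dimensional complex subspace $V_+\subset\mathbb{C}^6$ on which $H$ is positive definite, and let $W\otimes_{\mathbb{Q}}\mathbb{R}=\bigoplus_{p+q=3}W^{p,q}$ be the induced decomposition. Then there exists a $\mathbb{Q}$-vector subspace $W_+\subset W$ with $\dim_{\mathbb{Q}}W_+=20$ such that $$W_{+,\mathbb{C}}:=W_+\otimes_{\mathbb{Q}}\mathbb{C}=W\otimes_{\mathbb{Q}}\mathbb{R}\simeq\mathbb{C}^{20}\quad\text{and}\quad W_+^{p,q}=\overline{W_+^{q,p}}\quad (p+q=3),$$ i.e. $W_+$ carries a rational Hodge structure of weight $3$.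
   Context: Fix an embedding $\mathbb{K}\subset\mathbb{C}$, so $\mathbb{K}\otimes_{\mathbb{Q}}\mathbb{R}=\mathbb{C}$, $\mathbb{K}^6\otimes_{\mathbb{Q}}\mathbb{R}=\mathbb{C}^6$ and $W\otimes_{\mathbb{Q}}\mathbb{R}=\bigwedge^3_{\mathbb{C}}\mathbb{C}^6\simeq\mathbb{C}^{20}$ as complex vector spaces. $H$ is the Hermitian form on $\mathbb{C}^6$ given by $H(v,w)=\sum_{j=1}^6\epsilon_j\overline{v_j}w_j$, with $\epsilon_1=\epsilon_2=\epsilon_3=1$ and $\epsilon_4=\epsilon_5=\epsilon_6=-1$. For $V_+$ as in the claim, $V_-:=V_+^{\perp}$ (with respect to $H$), and $J=J_{V_+}$ is the $\mathbb{C}$-linear map on $\mathbb{C}^6=V_+\oplus V_-$ acting as $i$ on $V_+$ and as $-i$ on $V_-$; put $V^{1,0}=V_+$, $V^{0,1}=V_-$. $h:\mathbb{C}^*\to GL(\mathbb{C}^6)$ is $h(a+bi)=a\,\mathrm{Id}+bJ$, and $h_3=\bigwedge^3h:\mathbb{C}^*\to GL(W\otimes_{\mathbb{Q}}\mathbb{R})$, $h_3(z)(u\wedge v\wedge w)=h(z)u\wedge h(z)v\wedge h(z)w$. The subspace $W^{p,q}\subset W\otimes_{\mathbb{Q}}\mathbb{R}$ is $\{w : h_3(a+bi)w=(a+bi)^p(a-bi)^qw \text{ for all } a+bi\in\mathbb{C}^*\}$. The equality $W_+\otimes_{\mathbb{Q}}\mathbb{C}=W\otimes_{\mathbb{Q}}\mathbb{R}$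 means that the natural $\mathbb{C}$-linear map $W_+\otimes_{\mathbb{Q}}\mathbb{C}\to W\otimes_{\mathbb{Q}}\mathbb{R}$, $w\otimes z\mapsto zw$, is an isomorphism; $W_+^{p,q}$ is the subspace of $W_+\otimes_{\mathbb{Q}}\mathbb{C}$ corresponding to $W^{p,q}$, and the bar is complex conjugation on $W_+\otimes_{\mathbb{Q}}\mathbb{C}$ relative to $W_+\otimes_{\mathbb{Q}}\mathbb{R}$. A rational Hodge structure of weight $k$ is a $\mathbb{Q}$-vector space $V$ with a decomposition $V\otimes_{\mathbb{Q}}\mathbb{C}=\bigoplus_{p+q=k}V^{p,q}$ such that $\overline{V^{p,q}}=V^{q,p}$. *)

(* Defs.v *)
From HB Require Import structures.
From mathcomp Require Import all_boot all_order all_algebra all_field.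
From mathcomp Require Import boolp classical_sets reals.
From mathcomp Require Import complex ring lra zify.

Set Implicit Arguments.
Unset Strict Implicit.
Unset Printing Implicit Defensive.

Import Order.TTheory GRing.Theory Num.Theory.
Local Open Scope ring_scope.

(* The exterior cube of F^n is represented by coordinates in the basis
   e_i /\ e_j /\ e_k, i < j < k; its universal property is ext3_liftP and
   ext3_lift_uniq below.  Over a field K of type fieldExtType rat, ext3 n K is
   canonically a vectType rat; over a field F, ext3 n F^o is a vectType F. *)
Definition incr n := [pred t : 'I_n * 'I_n * 'I_n | (t.1.1 < t.1.2 < t.2)%N].
Notation triple n := {t | t \in incr n}.
Notation ext3 n F := {ffun triple n -> F}.

Definition tri_nth n (t : triple n) (a : 'I_3) : 'I_n :=
  tnth [tuple (val t).1.1; (val t).1.2; (val t).2] a.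

Definition wedge3 (F : fieldType) n (u v w : 'rV[F]_n) : ext3 n F^o :=
  [ffun t => \det (\matrix_(a < 3, b < 3) tnth [tuple u; v; w] a 0 (tri_nth t b))].

Definition alternating3 (F : fieldType) n (U : lmodType F)
    (f : 'rV[F]_n -> 'rV[F]_n -> 'rV[F]_n -> U) : Prop :=
  [/\ forall v w, linear (fun u => f u v w),
      forall u w, linear (fun v => f u v w),
      forall u v, linear (fun w => f u v w)
    & forall u v, f u u v = 0 /\ f u v v = 0].

Definition ext3_lift (F : fieldType) n (U : lmodType F)
    (f : 'rV[F]_n -> 'rV[F]_n -> 'rV[F]_n -> U) (x : ext3 n F^o) : U :=
  \sum_(t : triple n)
     x t *: f (delta_mx 0 (val t).1.1) (delta_mx 0 (val t).1.2) (delta_mx 0 (val t).2).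

Definition ext3_map (F : fieldType) n (g : 'rV[F]_n -> 'rV[F]_n) :
    ext3 n F^o -> ext3 n F^o :=
  ext3_lift (fun u v w => wedge3 (g u) (g v) (g w)).

Section ExteriorCube.
Variables (F : fieldType) (n : nat).
Implicit Types (u v w : 'rV[F]_n).

Lemma wedge3E u v w (t : triple n) (i := (val t).1.1) (j := (val t).1.2) (k := (val t).2) :
  wedge3 u v w t =
    u 0 i * v 0 j * w 0 k - u 0 i * v 0 k * w 0 j
  - u 0 j * v 0 i * w 0 k + u 0 j * v 0 k * w 0 i
  + u 0 k * v 0 i * w 0 j - u 0 k * v 0 j * w 0 i.
Proof.
rewrite ffunE (expand_det_row _ ord0) !big_ord_recl big_ord0.
rewrite /cofactor !(expand_det_row _ ord0) !big_ord_recl !big_ord0 /cofactor.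
rewrite !det_mx11 !mxE /=.
rewrite /tri_nth !(tnth_nth u) !(tnth_nth i) /= /bump /= -/i -/j -/k.
by rewrite !(expr0, expr1, exprS); ring.
Qed.

Lemma ext3_linE (a : F) (x y : ext3 n F^o) t : (a *: x + y) t = a * (x t : F) + (y t : F).
Proof. by rewrite !ffunE. Qed.

Lemma wedge3_alternating (f : 'rV[F]_n -> 'rV[F]_n) :
  linear f -> alternating3 (fun u v w => wedge3 (f u) (f v) (f w)).
Proof.
move=> lf; split=> [v w a u u' | u w a v v' | u v a w w' | u v].
- by apply/ffunP=> t; by rewrite ext3_linE !wedge3E lf !mxE; ring.
- by apply/ffunP=> t; by rewrite ext3_linE !wedge3E lf !mxE; ring.
- by apply/ffunP=> t; by rewrite ext3_linE !wedge3E lf !mxE; ring.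
- by split; apply/ffunP=> t; rewrite [RHS]ffunE !wedge3E; ring.
Qed.

Lemma linear_sum_delta (U : lmodType F) (g : 'rV[F]_n -> U) u :
  linear g -> g u = \sum_i u 0 i *: g (delta_mx 0 i).
Proof.
move=> lg; pose gL : {linear 'rV[F]_n -> U} := HB.pack g (GRing.isLinear.Build _ _ _ _ g lg).
rewrite -[LHS]/(gL u) {1}(row_sum_delta u) linear_sum.
by apply: eq_bigr => i _; rewrite linearZ.
Qed.

Lemma ext3_liftP (U : lmodType F) (f : 'rV[F]_n -> 'rV[F]_n -> 'rV[F]_n -> U) u v w :
  alternating3 f -> ext3_lift f (wedge3 u v w) = f u v w.
Proof.
case=> l1 l2 l3 f0; pose e i : 'rV[F]_n := delta_mx 0 i.
pose G i j k := f (e i) (e j) (e k).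
pose T (i j k : 'I_n) := (i < j < k)%N.
pose A i j k := (u 0 i * v 0 j * w 0 k) *: G i j k.
pose D i j k := u 0 i * v 0 j * w 0 k - u 0 i * v 0 k * w 0 j
  - u 0 j * v 0 i * w 0 k + u 0 j * v 0 k * w 0 i
  + u 0 k * v 0 i * w 0 j - u 0 k * v 0 j * w 0 i.
have add1 x y v' w' : f (x + y) v' w' = f x v' w' + f y v' w'.
  by have := l1 v' w' 1 x y; rewrite !scale1r.
have add2 x y u' w' : f u' (x + y) w' = f u' x w' + f u' y w'.
  by have := l2 u' w' 1 x y; rewrite !scale1r.
have add3 x y u' v' : f u' v' (x + y) = f u' v' x + f u' v' y.
  by have := l3 u' v' 1 x y; rewrite !scale1r.
have G12 i j k : G j i k = - G i j k.
  apply/eqP; rewrite -addr_eq0; have := (f0 (e i + e j) (e k)).1.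
  by rewrite add1 !add2 (f0 _ _).1 (f0 (e j) _).1 add0r addr0 addrC => /eqP.
have G23 i j k : G i k j = - G i j k.
  apply/eqP; rewrite -addr_eq0; have := (f0 (e i) (e j + e k)).2.
  by rewrite add2 !add3 (f0 _ (e j)).2 (f0 _ (e k)).2 add0r addr0 addrC => /eqP.
have Giik i k : G i i k = 0 by apply: (f0 _ _).1.
have Gikk i k : G i k k = 0 by apply: (f0 _ _).2.
have Giki i k : G i k i = 0 by rewrite G23 Giik oppr0.
have sw23 (S : 'I_n -> 'I_n -> 'I_n -> U) :
    \sum_i \sum_j \sum_k S i j k = \sum_i \sum_j \sum_k S i k j.
  by apply: eq_bigr => i _; rewrite exchange_big.
have sw12 (S : 'I_n -> 'I_n -> 'I_n -> U) :
    \sum_i \sum_j \sum_k S i j k = \sum_i \sum_j \sum_k S j i k.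
  by rewrite exchange_big.
have -> : ext3_lift f (wedge3 u v w) =
    \sum_i \sum_j \sum_k (D i j k *: G i j k) *+ T i j k.
  rewrite /ext3_lift.
  under eq_bigr do rewrite wedge3E.
  rewrite -(big_sub (incr n) (fun p => D p.1.1 p.1.2 p.2 *: G p.1.1 p.1.2 p.2)).
  rewrite pair_bigA pair_bigA /= big_mkcond; apply: eq_bigr => -[[i j] k] _ /=.
  by rewrite inE /= /T; case: ifP; rewrite ?mulr1n ?mulr0n.
have -> : f u v w = \sum_i \sum_j \sum_k A i j k.
  rewrite (linear_sum_delta u (l1 v w)); apply: eq_bigr => i _.
  rewrite (linear_sum_delta v (l2 _ w)) scaler_sumr; apply: eq_bigr => j _.
  rewrite (linear_sum_delta w (l3 _ _)) !scaler_sumr; apply: eq_bigr => k _.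
  by rewrite !scalerA.
have split6 i j k : A i j k = A i j k *+ T i j k + A i j k *+ T i k j
    + A i j k *+ T j i k + A i j k *+ T j k i + A i j k *+ T k i j + A i j k *+ T k j i.
  rewrite -!mulrnDr; have [E|NE] := boolP [|| i == j, j == k | i == k].
    suff -> : A i j k = 0 by rewrite mul0rn.
    by rewrite /A; case/or3P: E => /eqP->; rewrite ?Giik ?Gikk ?Giki scaler0.
  rewrite (_ : (_ + _)%N = 1%N) ?mulr1n //.
  by move: NE; rewrite -!val_eqE /T /=; case: (ltngtP i j) (ltngtP j k) (ltngtP i k)
    => [?|?|?] [?|?|?] [?|?|?] //=; lia.
pose Sm (S : 'I_n -> 'I_n -> 'I_n -> U) := \sum_i \sum_j \sum_k S i j k.
have SmD S1 S2 : Sm (fun i j k => S1 i j k + S2 i j k) = Sm S1 + Sm S2.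
  rewrite /Sm -big_split; apply: eq_bigr => i _; rewrite -big_split.
  by apply: eq_bigr => j _; rewrite -big_split.
have eqSm S1 S2 : (forall i j k, S1 i j k = S2 i j k) -> Sm S1 = Sm S2.
  by move=> eS; apply: eq_bigr => i _; apply: eq_bigr => j _; apply: eq_bigr => k _.
rewrite -[RHS]/(Sm A) (eqSm _ _ split6) !SmD.
rewrite [Sm (fun i j k => A i j k *+ T i k j)]sw23.
rewrite [Sm (fun i j k => A i j k *+ T j i k)]sw12.
rewrite [Sm (fun i j k => A i j k *+ T j k i)]sw12 [X in _ + X + _ + _]sw23.
rewrite [Sm (fun i j k => A i j k *+ T k i j)]sw23 [X in _ + X + _]sw12.
rewrite [Sm (fun i j k => A i j k *+ T k j i)]sw12 [X in _ + X]sw23 [X in _ + X]sw12.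
rewrite -!SmD; apply: eqSm => i j k; rewrite -!mulrnDl; congr (_ *+ _).
rewrite /A (G23 i j k) (G12 i j k) (G12 i k j) (G23 j i k) (G23 k i j) (G12 i k j).
rewrite (G12 i j k) (G23 i j k) ?opprK !scalerN -!scaleNr -!scalerDl.
by congr (_ *: _); rewrite /D; ring.
Qed.

Lemma incr_uniq (i j k a b c : 'I_n) :
  (i < j < k)%N -> (a < b < c)%N -> [|| a == i, a == j | a == k] ->
  [|| b == i, b == j | b == k] -> [|| c == i, c == j | c == k] ->
  (a, b, c) = (i, j, k).
Proof.
rewrite -!(inj_eq val_inj) /= => *.
by congr (_, _, _); apply: val_inj => /=; lia.
Qed.

Lemma ext3_lift_uniq (U : lmodType F) (g1 g2 : ext3 n F^o -> U) :
  linear g1 -> linear g2 ->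
  (forall u v w, g1 (wedge3 u v w) = g2 (wedge3 u v w)) -> g1 =1 g2.
Proof.
move=> lg1 lg2 eg x.
pose b (t : triple n) : ext3 n F^o :=
  wedge3 (delta_mx 0 (val t).1.1) (delta_mx 0 (val t).1.2) (delta_mx 0 (val t).2).
have bE t s : b t s = (s == t)%:R.
  case: t s => [[[i' j'] k'] pt] [[[i j] k] ps]; rewrite wedge3E !mxE eqxx /=.
  rewrite [X in _ = (nat_of_bool X)%:R](_ : _ = ((i, j, k) == (i', j', k'))) //.
  move: (pt) (ps); rewrite !inE /=.
  move=> /andP[ij' jk'] /andP[ij jk]; rewrite -!natrM !mulnb.
  have F0 (p q r : 'I_n) : (p, q, r) != (i, j, k) ->
      p \in [:: i; j; k] -> q \in [:: i; j; k] -> r \in [:: i; j; k] ->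
      (p == i') && (q == j') && (r == k') = false.
    move=> ne pin qin rin; apply/negP => /andP[/andP[/eqP pE /eqP qE] /eqP rE].
    case/eqP: ne; rewrite pE qE rE; move: pin qin rin; rewrite !inE pE qE rE.
    by apply: incr_uniq; rewrite ?ij ?jk ?ij'.
  have ne (p q : 'I_n) : (p < q)%N -> (p == q) = false.
    by move=> pq; apply/eqP => epq; rewrite epq ltnn in pq.
  have neij := ne _ _ ij; have nejk := ne _ _ jk; have neik := ne _ _ (ltn_trans ij jk).
  have E (p q r p' q' r' : 'I_n) : ((p, q, r) == (p', q', r')) = (p == p') && (q == q') && (r == r') by [].
  rewrite E (F0 i k j) ?(F0 j i k) ?(F0 j k i) ?(F0 k i j) ?(F0 k j i) ?inE ?eqxx ?orbT //;
    last 5 first; do ?by rewrite E ?(eq_sym k) ?(eq_sym j i) ?neij ?nejk ?neik ?andbF.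
  by rewrite !subr0 !addr0.
have xE : x = \sum_t x t *: b t.
  apply/ffunP => s; rewrite sum_ffunE (bigD1 s) //= big1 ?addr0 => [|t ts].
    by rewrite ffunE bE eqxx /GRing.scale /= mulr1.
  by rewrite ffunE bE eq_sym (negPf ts) scaler0.
pose L1 : {linear _ -> U} := HB.pack g1 (GRing.isLinear.Build _ _ _ _ g1 lg1).
pose L2 : {linear _ -> U} := HB.pack g2 (GRing.isLinear.Build _ _ _ _ g2 lg2).
rewrite -[g1 x]/(L1 x) -[g2 x]/(L2 x) xE !linear_sum; apply: eq_bigr => t _.
by rewrite !linearZ; congr (_ *: _); apply: eg.
Qed.

Lemma ext3_mapE (g : 'rV[F]_n -> 'rV[F]_n) u v w :
  linear g -> ext3_map g (wedge3 u v w) = wedge3 (g u) (g v) (g w).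
Proof. by move=> lg; rewrite /ext3_map ext3_liftP //; apply: wedge3_alternating. Qed.

Lemma ext3_lift_linear (U : lmodType F) (f : 'rV[F]_n -> 'rV[F]_n -> 'rV[F]_n -> U) :
  linear (ext3_lift f).
Proof.
move=> a x y; rewrite /ext3_lift scaler_sumr -big_split; apply: eq_bigr => t _.
by rewrite ext3_linE scalerDl scalerA.
Qed.
End ExteriorCube.

Section SubspaceOfPredicate.
Variables (F : fieldType) (V : vectType F).

(* The subspace with the given set of vectors; 0 if that set is not a subspace. *)
Definition vspace_of (P : V -> Prop) : {vspace V} :=
  xget 0%VS [set U : {vspace V} | forall v, v \in U <-> P v].

Lemma mem_vspace_of (P : V -> Prop) :
  P 0 -> (forall a u v, P u -> P v -> P (a *: u + v)) ->
  forall v, v \in vspace_of P <-> P v.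
Proof.
move=> P0 PD; rewrite /vspace_of; case: xgetP => [U _ //|noU]; exfalso.
pose Q n := `[< exists U : {vspace V}, \dim U = n /\ forall v, v \in U -> P v >].
have exQ : exists n, Q n.
  exists 0%N; apply/asboolP; exists 0%VS; split; first exact: dimv0.
  by move=> v; rewrite memv0 => /eqP->.
have leQ n : Q n -> (n <= dim V)%N.
  by move=> /asboolP[U [<- _]]; rewrite -dimvf dimvS ?subvf.
case: (ex_maxnP exQ leQ) => n /asboolP[U [dU UP]] maxn.
apply: (noU U) => v; split=> [|Pv]; first exact: UP.
apply: contraT => vU; suff : Q n.+1 by move/maxn; rewrite ltnn.
apply/asboolP; exists (<[v]> + U)%VS; split=> [|w /memv_addP[x /vlineP[a ->] [u uU ->]]]; last first.
  exact: PD (UP _ uU).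
have v0 : v != 0 by apply: contraNneq vU => ->; rewrite mem0v.
rewrite dimv_disjoint_sum ?dim_vline ?v0 ?dU //; apply/eqP; rewrite -subv0.
apply/subvP => x; rewrite memv_cap memv0 => /andP[/vlineP[a ->] avU].
have [->|a0] := eqVneq a 0; first by rewrite scale0r.
by case/negP: vU; rewrite -[v]scale1r -(mulVf a0) -scalerA memvZ.
Qed.

End SubspaceOfPredicate.

Section Complexification.
Variables (C : numClosedFieldType) (V : vectType rat).

(* V (x)_Q C, in coordinates with respect to the basis vbasis fullv of V. *)
Definition cplx := 'rV[C]_(\dim {:V}).

Definition ctensor (v : V) (z : C) : cplx :=
  \row_i (ratr (coord (vbasis {:V}) i v) * z).

Definition cplx_conj (x : cplx) : cplx := map_mx Num.conj x.

(* The C-linear map V (x)_Q C -> U sending v (x) z to z *: f v. *)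
Definition cplx_lift (U : vectType C) (f : V -> U) : 'Hom(cplx, U) :=
  linfun (fun x : cplx => \sum_i x 0 i *: f (vbasis {:V})`_i).

Lemma cplx_liftE (U : vectType C) (f : {additive V -> U}) v z :
  cplx_lift f (ctensor v z) = z *: f v.
Proof.
pose g (x : cplx) : U := \sum_i x 0 i *: f (vbasis {:V})`_i.
have lg : linear g.
  move=> a x y; rewrite /g scaler_sumr -big_split; apply: eq_bigr => i _.
  by rewrite !mxE scalerDl scalerA.
pose gL : {linear cplx -> U} := HB.pack g (GRing.isLinear.Build _ _ _ _ g lg).
rewrite /cplx_lift -/g -[g]/(gL : _ -> _) lfunE /= /g.
have fZ (a : rat) (x : V) : f (a *: x) = ratr a *: f x.
  have d0 : (denq a)%:~R != 0 :> C by rewrite intr_eq0 denq_neq0.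
  apply: (scalerI d0); rewrite scalerA /ratr mulrC divfK // !scaler_int -!(raddfMz f).
  by congr (f _); rewrite -[LHS]scaler_int -[RHS]scaler_int scalerA mulrC -numqE.
rewrite {2}(coord_vbasis (memvf v)) raddf_sum scaler_sumr; apply: eq_bigr => i _.
by rewrite mxE fZ scalerA mulrC.
Qed.

Lemma cplx_conjE v z : cplx_conj (ctensor v z) = ctensor v z^*.
Proof. by apply/rowP => i; rewrite !mxE rmorphM /= fmorph_rat. Qed.

Lemma cplx_gen (x : cplx) : x = \sum_(i < \dim {:V}) ctensor (vbasis {:V})`_i (x 0 i).
Proof.
apply/rowP => j; rewrite summxE (bigD1 j) //= big1 => [|i ij].
  by rewrite mxE coord_free ?(basis_free (vbasisP _)) // eqxx rmorph1 mul1r addr0.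
by rewrite mxE coord_free ?(basis_free (vbasisP _)) // (negPf ij) rmorph0 mul0r.
Qed.

(* The sum over all p in int is expressed through its finitely many nonzero
   terms. *)
Definition rational_hodge_structure (k : int) (Vpq : int -> int -> {vspace cplx}) : Prop :=
  (exists s : seq int,
     [/\ uniq s,
         forall p, p \notin s -> Vpq p (k - p) = 0%VS,
         directv (\sum_(p <- s) Vpq p (k - p))
       & (\sum_(p <- s) Vpq p (k - p))%VS = fullv]) /\
  (forall p q, p + q = k ->
     (cplx_conj @` [set` Vpq p q] = [set` Vpq q p])%classic).

End Complexification.

Section HodgeOfPositiveSubspace.
Variable C : numClosedFieldType.
Implicit Types (Vp : {vspace 'rV[C]_6}).

Definition hform (v w : 'rV[C]_6) : C :=
  \sum_(j < 6) (if (j < 3)%N then 1 else - 1) * (v 0 j)^* * w 0 j.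

Definition positive_on Vp : Prop := forall v, v \in Vp -> v != 0 -> 0 < hform v v.

Definition Vminus Vp : {vspace 'rV[C]_6} :=
  (\bigcap_(u <- vbasis Vp) lker (linfun (hform u : 'rV[C]_6 -> C^o)))%VS.

(* Vp and Vminus Vp are complementary when Vp is positive, see
   Vplus_cap_Vminus and Vplus_add_Vminus below. *)
Definition Jplus Vp : 'End('rV[C]_6) :=
  'i *: daddv_pi Vp (Vminus Vp) - 'i *: daddv_pi (Vminus Vp) Vp.

Definition hodge_h Vp (z : C) (v : 'rV[C]_6) : 'rV[C]_6 := 'Re z *: v + 'Im z *: Jplus Vp v.

Definition hodge_h3 Vp (z : C) : ext3 6 C^o -> ext3 6 C^o := ext3_map (hodge_h Vp z).

Definition hodge_piece Vp (p q : int) : {vspace ext3 6 C^o} :=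
  vspace_of (fun w : ext3 6 C^o =>
    forall z : C, z != 0 -> hodge_h3 Vp z w = (z ^ p * z^* ^ q) *: w).

Lemma hform_linear v : linear (hform v : 'rV[C]_6 -> C^o).
Proof.
move=> a x y; rewrite /hform scaler_sumr -big_split; apply: eq_bigr => j _.
by rewrite !mxE /GRing.scale /=; ring.
Qed.

Lemma linfun_hform u v : linfun (hform u : 'rV[C]_6 -> C^o) v = hform u v.
Proof.
pose gL : {linear 'rV[C]_6 -> C^o} :=
  HB.pack (hform u : _ -> C^o) (GRing.isLinear.Build _ _ _ _ _ (hform_linear u)).
exact: (lfunE gL).
Qed.

Lemma mem_Vminus Vp v : v \in Vminus Vp <-> forall u, u \in Vp -> hform u v = 0.
Proof.
have -> : v \in Vminus Vp = all (fun u => hform u v == 0) (vbasis Vp).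
  rewrite /Vminus; elim: (tval (vbasis Vp)) => [|u s IH]; first by rewrite big_nil memvf.
  by rewrite big_cons memv_cap IH memv_ker linfun_hform.
split=> [/allP h u uV|h]; last by apply/allP => u us; rewrite h ?vbasis_mem.
rewrite (coord_vbasis uV) /hform.
under eq_bigr do rewrite summxE rmorph_sum mulr_sumr mulr_suml /=.
rewrite exchange_big big1 // => i _ /=.
have /h/eqP : (vbasis Vp)`_i \in vbasis Vp by rewrite mem_nth ?size_tuple.
rewrite /hform => h0; rewrite -[RHS](mulr0 (coord (vbasis Vp) i u)^*) -[in RHS]h0 mulr_sumr.
by apply: eq_bigr => j _; rewrite mxE rmorphM /=; ring.
Qed.

Lemma Vplus_cap_Vminus Vp : positive_on Vp -> (Vp :&: Vminus Vp = 0)%VS.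
Proof.
move=> Vpos; apply/eqP; rewrite -subv0; apply/subvP => v; rewrite memv_cap memv0.
move=> /andP[vp /mem_Vminus/(_ _ vp) v0]; apply: contraT => /(Vpos _ vp).
by rewrite v0 ltxx.
Qed.

Lemma dim_cap_lker (U : {vspace 'rV[C]_6}) (f : 'Hom('rV[C]_6, C^o)) :
  (\dim U <= (\dim (U :&: lker f)).+1)%N.
Proof.
have le1 : (\dim (f @: U) <= 1)%N by apply: leq_trans (dimvS (subvf _)) _; rewrite dimvf.
by rewrite -(limg_ker_dim f U) -[leqRHS]addn1 leq_add2l.
Qed.

Lemma Vplus_add_Vminus Vp : positive_on Vp -> (Vp + Vminus Vp = fullv)%VS.
Proof.
move=> Vpos; apply/eqP; rewrite eqEdim subvf /= dimv_disjoint_sum ?Vplus_cap_Vminus //.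
suff dl (s : seq 'rV[C]_6) :
    (6 <= size s + \dim (\bigcap_(u <- s) lker (linfun (hform u : 'rV[C]_6 -> C^o)))%VS)%N.
  by rewrite dimvf /= /dim /= mul1n; have := dl (vbasis Vp); rewrite size_tuple.
elim: s => [|u s IH]; first by rewrite big_nil dimvf.
rewrite big_cons capvC /= addSnnS; apply: leq_trans IH _.
by rewrite leq_add2l dim_cap_lker.
Qed.

Lemma Jplus_pos Vp v : positive_on Vp -> v \in Vp -> Jplus Vp v = 'i *: v.
Proof.
move=> /Vplus_cap_Vminus dV vV; rewrite /Jplus add_lfunE opp_lfunE !scale_lfunE.
have dV' : (Vminus Vp :&: Vp = 0)%VS by rewrite capvC.
rewrite daddv_pi_id // (_ : daddv_pi (Vminus Vp) Vp v = 0) ?scaler0 ?subr0 //.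
have := daddv_pi_add dV' (_ : v \in (Vminus Vp + Vp)%VS).
by rewrite (daddv_pi_id dV) // => /(_ (subvP (addvSr _ _) _ vV)) /(canRL (addrK _)); rewrite subrr.
Qed.

Lemma Jplus_neg Vp v : positive_on Vp -> v \in Vminus Vp -> Jplus Vp v = - 'i *: v.
Proof.
move=> /Vplus_cap_Vminus dV vV; rewrite /Jplus add_lfunE opp_lfunE !scale_lfunE.
have dV' : (Vminus Vp :&: Vp = 0)%VS by rewrite capvC.
rewrite scaleNr (daddv_pi_id dV') // (_ : daddv_pi Vp (Vminus Vp) v = 0) ?scaler0 ?sub0r //.
have := daddv_pi_add dV (_ : v \in (Vp + Vminus Vp)%VS).
by rewrite (daddv_pi_id dV') // => /(_ (subvP (addvSr _ _) _ vV)) /(canRL (addrK _)); rewrite subrr.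
Qed.

Lemma hodge_h3E Vp z u v w :
  hodge_h3 Vp z (wedge3 u v w) =
    wedge3 (hodge_h Vp z u) (hodge_h Vp z v) (hodge_h Vp z w).
Proof.
apply: ext3_mapE => a x y; rewrite /hodge_h (linearP (Jplus Vp)) !scalerDr !scalerA.
by rewrite ![_ * a]mulrC addrACA.
Qed.

Lemma mem_hodge_piece Vp p q w :
  w \in hodge_piece Vp p q <->
  forall z : C, z != 0 -> hodge_h3 Vp z w = (z ^ p * z^* ^ q) *: w.
Proof.
apply: mem_vspace_of => [z _|a u v hu hv z z0].
  by rewrite scaler0 /hodge_h3 /ext3_map /ext3_lift big1 // => t _; rewrite ffunE scale0r.
rewrite /hodge_h3 /ext3_map ext3_lift_linear -!/(ext3_map _ _) -!/(hodge_h3 _ _ _).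
by rewrite hu // hv // scalerDr !scalerA mulrC.
Qed.

End HodgeOfPositiveSubspace.

Section ExtensionOfScalars.
Variables (C : numClosedFieldType) (K : fieldExtType rat) (iota : {rmorphism K -> C}).

(* The inclusion of the exterior cube of K^n in that of C^n = K^n (x)_Q R
   given by the embedding iota. *)
Definition ext3_embed n (w : ext3 n K) : ext3 n C^o := [ffun t => iota (w t)].

Lemma ext3_embed_wedge n (u v w : 'rV[K]_n) :
  ext3_embed (wedge3 u v w) = wedge3 (map_mx iota u) (map_mx iota v) (map_mx iota w).
Proof.
by apply/ffunP => t; rewrite [LHS]ffunE !wedge3E !mxE !(rmorphD, rmorphB, rmorphN, rmorphM).
Qed.

Definition complexified_inclusion n (Wp : {vspace ext3 n K}) :
    'Hom(cplx C (subvs_of Wp), ext3 n C^o) :=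
  cplx_lift (fun w : subvs_of Wp => ext3_embed (vsval w)).

Lemma complexified_inclusionE n (Wp : {vspace ext3 n K}) w z :
  complexified_inclusion Wp (ctensor w z) = z *: ext3_embed (vsval w).
Proof.
pose e (w : subvs_of Wp) := ext3_embed (vsval w).
have eB : {morph e : x y / x - y}.
  by move=> x y; apply/ffunP => t; rewrite /e raddfB !ffunE rmorphB.
pose eA : {additive subvs_of Wp -> ext3 n C^o} :=
  HB.pack e (GRing.isZmodMorphism.Build _ _ e eB).
exact: (cplx_liftE eA).
Qed.

End ExtensionOfScalars.

(* Main.v *)
Require Import Defs.
From HB Require Import structures.
From mathcomp Require Import all_boot all_order all_algebra all_field.
From mathcomp Require Import boolp classical_sets reals.
From mathcomp Require Import complex ring zify perm.

(* The form x, y |-> x /\ y in det C^6 = C and the Hermitian form on the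
   exterior cube induced by H define an antilinear operator tau by
   H(tau x, y) = x /\ y.  Since H has signature (3, 3), tau is an involution;
   its matrix has entries 0, 1, -1, so it preserves W, and
   W_+ = {w in W | tau w = w} is a real form of W (x) R, defined over Q, whose
   complex conjugation is tau.  As h(z) multiplies H by |z|^2 and has
   determinant |z|^6, tau commutes with h_3(z), and being antilinear it maps
   W^{p,q} to W^{q,p}. *)

Set Implicit Arguments.
Unset Strict Implicit.
Unset Printing Implicit Defensive.

Import Order.TTheory GRing.Theory Num.Theory.
Local Open Scope ring_scope.

(** * Increasing triples of indices and their complements *)

Section Triples.
Implicit Types (s t : triple 6).

Lemma triple_bounds t : ((val t).1.1 < (val t).1.2 < (val t).2)%N.
Proof. by case: t. Qed.

Definition triple_seq t : seq 'I_6 := [:: (val t).1.1; (val t).1.2; (val t).2].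

Definition triple_cat s t : 6.-tuple 'I_6 :=
  [tuple (val s).1.1; (val s).1.2; (val s).2; (val t).1.1; (val t).1.2; (val t).2].

Lemma triple_compl t : exists s, uniq (triple_cat t s).
Proof.
pose r := iota 0 6.
(* The complement is searched for among natural numbers, where the check evaluates, and is then
   carried back to ordinals. *)
have : all (fun a => all (fun b => all (fun c => (a < b < c)%N ==>
    has (fun a' => has (fun b' => has (fun c' => (a' < b' < c')%N &&
      uniq [:: a; b; c; a'; b'; c']) r) r) r) r) r) r by vm_compute.
case: t => [[[a b] c] abc].
have inr (i : 'I_6) : val i \in r by rewrite mem_iota ltn_ord.
move=> /allP/(_ _ (inr a))/allP/(_ _ (inr b))/allP/(_ _ (inr c)).
move=> /implyP/(_ abc).
move=> /hasP[a' + /hasP[b' + /hasP[c' + /andP[lt u]]]].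
rewrite !mem_iota => /andP[_ ha] /andP[_ hb] /andP[_ hc].
pose s : triple 6 := exist _ (Ordinal ha, Ordinal hb, Ordinal hc) lt.
by exists s; apply: (@map_uniq _ _ (@nat_of_ord 6)); exact: u.
Qed.

Lemma triple_cat_full s t i : uniq (triple_cat s t) -> i \in triple_cat s t.
Proof.
move=> u; have sub : {subset triple_cat s t <= enum 'I_6} by move=> x _; rewrite mem_enum.
have [|_ ->] := uniq_min_size u sub; last by rewrite mem_enum.
by rewrite size_enum_ord size_tuple.
Qed.

(** The entries of [s] and those of [t] both form the complement of the entries of [r], and an
    increasing triple is determined by its set of entries. *)
Lemma triple_compl_inj r s t :
  uniq (triple_cat r s) -> uniq (triple_cat r t) -> s = t.
Proof.
move=> urs urt; apply: val_inj.
have sub i : i \in triple_seq s -> i \in triple_seq t.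
  move=> si; have : i \in triple_seq r ++ triple_seq t := triple_cat_full i urt.
  rewrite mem_cat => /orP[ri|//].
  have : uniq (triple_seq r ++ triple_seq s) := urs.
  by rewrite cat_uniq => /and3P[_ /hasPn/(_ _ si)]; rewrite /= ri.
have := triple_bounds s; have := triple_bounds t.
case: s t {urs urt} sub => [[[a b] c] ?] [[[i j] k] ?] /= sub lt1 lt2.
by apply: (incr_uniq lt1 lt2); [move: (sub a)|move: (sub b)|move: (sub c)];
  rewrite !inE eqxx ?orbT => /(_ isT).
Qed.

Lemma card_triple : #|{: triple 6}| = 20%N.
Proof.
rewrite card_sig -sum1_card big_mkcond /=.
transitivity (\sum_(i < 6) \sum_(j < 6) \sum_(k < 6) (i < j < k : nat))%N.
  by rewrite pair_bigA pair_bigA; apply: eq_bigr => -[[i j] k] _ /=; rewrite !inE; case: (_ && _).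
by rewrite !big_ord_recl !big_ord0.
Qed.
End Triples.

(** * Signs of the Hermitian form and of the wedge product on basis vectors *)

Section SignedVolume.
Variable F : fieldType.
Implicit Types (r s t : triple 6).

Definition sig33 (j : 'I_6) : F := if (j < 3)%N then 1 else - 1.

(** The value at $(e_t,e_t)$ of the Hermitian form induced by $H$ on the exterior cube. *)
Definition sig33_3 t : F := sig33 (val t).1.1 * sig33 (val t).1.2 * sig33 (val t).2.

(* e_s /\ e_t = vol s t * e_0 /\ ... /\ e_5 *)
Definition vol s t : F := \det (\matrix_(i, j) (tnth (triple_cat s t) i == j)%:R).

Lemma sig33_3_sqr t : sig33_3 t * sig33_3 t = 1.
Proof.
by rewrite /sig33_3 /sig33; do 3!case: ifP => _; ring.
Qed.

Lemma vol_perm s t : uniq (triple_cat s t) ->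
  exists p : {perm 'I_6}, p =1 tnth (triple_cat s t) /\ vol s t = (-1) ^+ p.
Proof.
move/tuple_uniqP => inj; exists (perm inj); split; first exact: permE.
rewrite /vol -det_perm; congr (\det _); apply/matrixP => i j.
by rewrite !mxE permE.
Qed.

Lemma vol0 s t : ~~ uniq (triple_cat s t) -> vol s t = 0.
Proof.
move=> nu; have [i [j [ij eij]]] : exists i j, i != j /\
    tnth (triple_cat s t) i = tnth (triple_cat s t) j.
  apply: contrapT => nex; case/negP: nu; apply/tuple_uniqP => i j eij.
  by apply: contrapT => /eqP ij; apply: nex; exists i, j.
by apply: determinant_alternate ij _ => k; rewrite !mxE eij.
Qed.

Lemma vol_sqr s t : uniq (triple_cat s t) -> vol s t * vol s t = 1.
Proof. by case/vol_perm=> p [_ ->]; rewrite -signr_addb addbb. Qed.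

(** Complementary triples together run through all six indices, so this is the product of all the
    $\epsilon_j$, three of which are negative. *)
Lemma sig33_3_compl s t : uniq (triple_cat s t) -> sig33_3 s * sig33_3 t = - 1.
Proof.
case/vol_perm=> p [pE _].
transitivity (\prod_i sig33 (tnth (triple_cat s t) i)).
  by rewrite !big_ord_recl big_ord0 !(tnth_nth ord0) /= /sig33_3 mulr1 !mulrA.
transitivity (\prod_j sig33 j).
  by rewrite [RHS](reindex_inj (@perm_inj _ p)); apply: eq_bigr => i _; rewrite pE.
by rewrite !big_ord_recl big_ord0 /sig33 /=; ring.
Qed.

(** Exchanges the two halves of a sextuple. As a product of three disjoint transpositions it is odd,
    which makes the wedge pairing on the exterior cube skew-symmetric. *)
Definition swap33 : {perm 'I_6} :=
  (tperm (inord 0) (inord 3) * tperm (inord 1) (inord 4) * tperm (inord 2) (inord 5))%g.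

Lemma swap33_odd : swap33 = true :> bool.
Proof. by rewrite /swap33 !odd_permM !odd_tperm -!val_eqE /= !inordK. Qed.

Lemma tnth_swap33 (T : Type) (a b c d e f : T) i :
  tnth [tuple a; b; c; d; e; f] (swap33 i) = tnth [tuple d; e; f; a; b; c] i.
Proof.
rewrite !(tnth_nth a) /swap33 !permM !permE /=.
case: i => [[|[|[|[|[|[|//]]]]]] hi] /=; rewrite -!val_eqE /= ?inordK //=;
  do ?[case: ifP => //= ]; rewrite -?val_eqE /= ?inordK //=.
Qed.

Lemma det_swap33 (u v w u' v' w' : 'rV[F]_6) :
  \det (\matrix_i tnth [tuple u'; v'; w'; u; v; w] i) =
  - 1 * \det (\matrix_i tnth [tuple u; v; w; u'; v'; w'] i).
Proof.
have <- : \det (perm_mx swap33) = - 1 :> F by rewrite det_perm swap33_odd.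
rewrite -det_mulmx -row_permE.
by congr (\det _); apply/matrixP => i j; rewrite !mxE tnth_swap33.
Qed.

Lemma volE s t : vol s t = \det (\matrix_i
  tnth [tuple delta_mx 0 (val s).1.1; delta_mx 0 (val s).1.2; delta_mx 0 (val s).2;
       delta_mx 0 (val t).1.1; delta_mx 0 (val t).1.2; delta_mx 0 (val t).2] i).
Proof.
congr (\det _); apply/matrixP => i j; rewrite !mxE.
by case: i => [[|[|[|[|[|[|//]]]]]] hi]; rewrite (tnth_nth ord0) (tnth_nth 0) /= mxE eqxx eq_sym.
Qed.

Lemma volC s t : vol t s = - vol s t.
Proof. by rewrite !volE det_swap33 mulN1r. Qed.

(** Coordinate form of $\tau^2=1$. Only the complement of [r] contributes to the sum; for [t = r]
    the sign from the skew symmetry of [vol] cancels the sign $(-1)^3$ from the signature. *)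
Lemma vol_involutive r t :
  \sum_s vol r s * sig33_3 s * vol s t * sig33_3 t = (r == t)%:R.
Proof.
have [s0 us0] := triple_compl r.
rewrite (bigD1 s0) //= big1 ?addr0 => [|s /eqP ss0]; last first.
  by rewrite (vol0 (s := r)) ?mul0r //; apply/negP => /triple_compl_inj/(_ us0).
have [<-|rt] := eqVneq r t.
  transitivity (- (vol r s0 * vol r s0) * (sig33_3 r * sig33_3 s0)).
    by rewrite (volC r s0); ring.
  by rewrite vol_sqr // sig33_3_compl // mulrNN mulr1.
rewrite (vol0 (s := s0)) ?mulr0 ?mul0r //; apply: contraNN rt => us0t.
apply/eqP; apply: triple_compl_inj us0t.
by move: us0; rewrite -[uniq _]/(uniq (triple_seq r ++ triple_seq s0)) uniq_catC.
Qed.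

End SignedVolume.

(** * The wedge pairing on the exterior cube *)

Section Pairing.
Variable F : fieldType.
Implicit Types (u v w : 'rV[F]_6) (x y : ext3 6 F^o) (s t : triple 6).

Definition vol6 u v w u' v' w' : F^o := \det (\matrix_i tnth [tuple u; v; w; u'; v'; w'] i).

Lemma vol6_mulmx (M : 'M_6) u v w u' v' w' :
  vol6 (u *m M) (v *m M) (w *m M) (u' *m M) (v' *m M) (w' *m M) =
  vol6 u v w u' v' w' * \det M.
Proof.
rewrite /vol6 -det_mulmx; congr (\det _); apply/row_matrixP => i.
rewrite row_mul !rowK.
by case: i => [[|[|[|[|[|[|//]]]]]] hi]; rewrite !(tnth_nth 0).
Qed.

(** Only the first three slots are treated; the last three are brought there by [det_swap33]. *)
Lemma vol6_alternating u' v' w' : alternating3 (fun u v w => vol6 u v w u' v' w').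
Proof.
have lin (i0 : 'I_6) (X Y Z : 6.-tuple 'rV[F]_6) (a : F) :
    tnth X i0 = a *: tnth Y i0 + tnth Z i0 ->
    (forall i, i != i0 -> tnth Y i = tnth X i /\ tnth Z i = tnth X i) ->
    \det (\matrix_i tnth X i) = a * \det (\matrix_i tnth Y i) + \det (\matrix_i tnth Z i).
  move=> E0 E; rewrite -[\det (\matrix_i tnth Z i)]mul1r.
  apply: (@determinant_multilinear _ _ _ _ _ i0).
  - by rewrite !rowK E0 scale1r.
  - by apply/matrixP => i k; rewrite !mxE (E (lift i0 i) _).1 // eq_sym neq_lift.
  - by apply/matrixP => i k; rewrite !mxE (E (lift i0 i) _).2 // eq_sym neq_lift.
have alt (i j : 'I_6) (X : 6.-tuple 'rV[F]_6) : i != j -> tnth X i = tnth X j ->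
    \det (\matrix_i tnth X i) = 0.
  by move=> ij E; apply: determinant_alternate ij _ => k; rewrite !mxE E.
split=> [v w a u1 u2|u w a v1 v2|u v a w1 w2|u v].
- apply: (lin (inord 0)); first by rewrite !(tnth_nth 0) inordK.
  by case=> [[|[|[|[|[|[|//]]]]]] hi]; rewrite -val_eqE /= inordK // !(tnth_nth 0).
- apply: (lin (inord 1)); first by rewrite !(tnth_nth 0) inordK.
  by case=> [[|[|[|[|[|[|//]]]]]] hi]; rewrite -val_eqE /= inordK // !(tnth_nth 0).
- apply: (lin (inord 2)); first by rewrite !(tnth_nth 0) inordK.
  by case=> [[|[|[|[|[|[|//]]]]]] hi]; rewrite -val_eqE /= inordK // !(tnth_nth 0).
- split; [apply: (alt (inord 0) (inord 1))|apply: (alt (inord 1) (inord 2))];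
    by rewrite ?(tnth_nth 0) -?val_eqE /= !inordK.
Qed.

(** The wedge product of [x] and [y], as a multiple of $e_0\wedge\dots\wedge e_5$. *)
Definition pairing x y : F := \sum_s \sum_t x s * y t * vol F s t.

Lemma pairing_wedge u v w u' v' w' :
  pairing (wedge3 u v w) (wedge3 u' v' w') = vol6 u v w u' v' w'.
Proof.
rewrite -(ext3_liftP u v w (vol6_alternating u' v' w')).
apply: eq_bigr => s _; under eq_bigr do rewrite -mulrA; rewrite -mulr_sumr; congr (_ * _).
(* Swapping the halves allows the universal property to be used for the second triple too; the sign
   is absorbed by [volC]. *)
rewrite /vol6 det_swap33 mulN1r -/(vol6 _ _ _ _ _ _).
rewrite -(ext3_liftP u' v' w' (vol6_alternating _ _ _)) -sumrN.
by apply: eq_bigr => t _; rewrite volC volE mulrN.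
Qed.

End Pairing.

(** * The Hermitian form induced on the exterior cube *)

Section HermitianCube.
Variable C : numClosedFieldType.
Implicit Types (u v w : 'rV[C]_6) (x y : ext3 6 C^o) (s t : triple 6).

Definition hform3 x y : C := \sum_t sig33_3 C t * (x t)^* * y t.

(** The determinant of the $3\times 3$ matrix of values of [hform] between the two triples of
    vectors. *)
Definition gram3 u v w u' v' w' : C :=
    hform u u' * hform v v' * hform w w' - hform u u' * hform v w' * hform w v'
  - hform u v' * hform v u' * hform w w' + hform u v' * hform v w' * hform w u'
  + hform u w' * hform v u' * hform w v' - hform u w' * hform v v' * hform w u'.

Lemma hform_delta u j : hform u (delta_mx 0 j) = sig33 C j * (u 0 j)^*.
Proof.
rewrite /hform (bigD1 j) //= big1 ?addr0 => [|i ij]; first by rewrite mxE !eqxx mulr1.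
by rewrite mxE (negPf ij) andbF mulr0.
Qed.

Lemma gram3_alternating u v w : alternating3 (gram3 u v w : _ -> _ -> _ -> C^o).
Proof.
have lf (p q r : 'rV[C]_6) a : hform p (a *: q + r) = a * hform p q + hform p r.
  by apply: hform_linear.
split=> [v' w' a u1 u2|u' w' a v1 v2|u' v' a w1 w2|u' v'];
  rewrite /gram3 ?lf /GRing.scale /=; [ring|ring|ring|split; ring].
Qed.

(** This identifies [hform3] as the form induced by $H$. By the universal property in the second
    argument it is enough to compare on basis vectors, where [gram3] is the conjugate of a
    coordinate of [wedge3 u v w] up to the sign [sig33_3]. *)
Lemma hform3_wedge u v w u' v' w' :
  hform3 (wedge3 u v w) (wedge3 u' v' w') = gram3 u v w u' v' w'.
Proof.
rewrite -[RHS](ext3_liftP u' v' w' (gram3_alternating u v w)).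
apply: eq_bigr => t _; rewrite mulrC; congr (_ * _).
rewrite /gram3 !hform_delta wedge3E /sig33_3 !(rmorphD, rmorphN, rmorphM) /=.
by ring.
Qed.

End HermitianCube.

(** * The operator $h(z)$: its effect on $H$ and its determinant *)

Section HodgeOperator.
Variables (C : numClosedFieldType) (Vp : {vspace 'rV[C]_6}).
Hypotheses (dimVp : \dim Vp = 3%N) (Vpos : positive_on Vp).
Implicit Types (u v w : 'rV[C]_6) (x y : ext3 6 C^o) (z : C) (s t : triple 6).

Lemma Vplus_Vminus_split u : exists a b, [/\ a \in Vp, b \in Vminus Vp & u = a + b].
Proof.
have : u \in (Vp + Vminus Vp)%VS by rewrite Vplus_add_Vminus ?memvf.
by case/memv_addP=> a aV [b bV ->]; exists a, b.
Qed.

Lemma hodge_hE z a b : a \in Vp -> b \in Vminus Vp ->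
  hodge_h Vp z (a + b) = z *: a + z^* *: b.
Proof.
move=> aV bV; rewrite /hodge_h (linearD (Jplus Vp)) /= Jplus_pos // Jplus_neg //.
rewrite !scalerDr !scalerA addrACA -!scalerDl mulrN.
have zc : z^* = 'Re z - 'i * 'Im z by rewrite {1}[z]Crect conjC_rect ?Creal_Re ?Creal_Im.
by rewrite zc {5}[z]Crect ![_ * 'i]mulrC.
Qed.

Lemma hodge_hKV z u : z != 0 -> hodge_h Vp z (hodge_h Vp z^-1 u) = u.
Proof.
move=> z0; have [a [b [aV bV ->]]] := Vplus_Vminus_split u.
rewrite (hodge_hE _ aV bV) hodge_hE ?memvZ // !scalerA fmorphV.
by rewrite !divff ?conjC_eq0 // !scale1r.
Qed.

Lemma hformC u v : hform u v = (hform v u)^*.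
Proof.
rewrite /hform rmorph_sum; apply: eq_bigr => j _; rewrite !rmorphM /= conjCK.
by case: ifP => _; rewrite ?rmorphN ?rmorph1 /=; ring.
Qed.

Lemma hform_sesquilinear u v u' v' (a b a' b' : C) :
  hform (a *: u + b *: v) (a' *: u' + b' *: v') =
    a^* * a' * hform u u' + a^* * b' * hform u v' + b^* * a' * hform v u' + b^* * b' * hform v v'.
Proof.
rewrite /hform !mulr_sumr -!big_split; apply: eq_bigr => j _.
by rewrite !mxE !(rmorphD, rmorphM) /=; ring.
Qed.

(** $V_+$ and $V_-$ are orthogonal, and $h(z)$ acts on them by scalars of the same absolute
    value. *)
Lemma hform_hodge z u v : hform (hodge_h Vp z u) (hodge_h Vp z v) = (z * z^*) * hform u v.
Proof.
have [a [b [aV bV ->]]] := Vplus_Vminus_split u.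
have [a' [b' [aV' bV' ->]]] := Vplus_Vminus_split v.
have ab : hform a b' = 0 by move/mem_Vminus: bV'; apply.
have ba : hform b a' = 0 by rewrite hformC; move/mem_Vminus: bV => ->; rewrite ?rmorph0.
rewrite !hodge_hE // hform_sesquilinear.
have := hform_sesquilinear a b a' b' 1 1 1 1; rewrite !scale1r => ->.
by rewrite ab ba conjC1 conjCK; ring.
Qed.

Lemma det_scale_rows n (d : 'rV[C]_n) (X : 'I_n -> 'rV[C]_n) :
  \det (\matrix_i (d 0 i *: X i)) = (\prod_i d 0 i) * \det (\matrix_i X i).
Proof.
rewrite -det_diag -det_mulmx; congr (\det _); apply/row_matrixP => i.
by rewrite rowK row_mul row_diag_mx -scalemxAl -rowE rowK.
Qed.

Definition hodge_mx z : 'M[C]_6 := ('Re z)%:M + 'Im z *: lin1_mx (Jplus Vp).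

Lemma mul_hodge_mx z u : u *m hodge_mx z = hodge_h Vp z u.
Proof. by rewrite mulmxDr mul_mx_scalar -scalemxAr mul_rV_lin1. Qed.

Lemma dim_Vminus : \dim (Vminus Vp) = 3%N.
Proof.
have := dimv_disjoint_sum (Vplus_cap_Vminus Vpos).
by rewrite Vplus_add_Vminus // dimvf dimVp /dim /= => -[].
Qed.

(** In a basis adapted to $V_+\oplus V_-$ the operator is diagonal, with $z$ and $\bar z$ three
    times each. The identity is proved after multiplication by the nonzero determinant of that
    basis. *)
Lemma det_hodge_mx z : \det (hodge_mx z) = (z * z^*) ^+ 3.
Proof.
have [[f0 [f1 [f2 fE]]] [g0 [g1 [g2 gE]]]] :
    (exists f0 f1 f2, vbasis Vp = [:: f0; f1; f2] :> seq _) /\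
    (exists g0 g1 g2, vbasis (Vminus Vp) = [:: g0; g1; g2] :> seq _).
  have ex3 (X : seq 'rV[C]_6) : size X = 3%N -> exists a b c, X = [:: a; b; c].
    by case: X => [|a [|b [|c []]]] // _; exists a, b, c.
  by split; apply: ex3; rewrite size_tuple ?dim_Vminus.
have fV f : f \in [:: f0; f1; f2] -> f \in Vp by rewrite -fE; apply: vbasis_mem.
have gV g : g \in [:: g0; g1; g2] -> g \in Vminus Vp by rewrite -gE; apply: vbasis_mem.
pose X := [tuple f0; f1; f2; g0; g1; g2].
have Xfree : free X.
  rewrite (_ : tval X = vbasis Vp ++ vbasis (Vminus Vp)) ?fE ?gE // -fE -gE.
  rewrite cat_free !(basis_free (vbasisP _)) /=; apply/directv_addP.
  by rewrite !(span_basis (vbasisP _)) Vplus_cap_Vminus.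
have D0 : \det (\matrix_i tnth X i) != 0.
  rewrite -unitfE -unitmxE -row_free_unit.
  apply: inj_row_free => v; rewrite mulmx_sum_row => v0; apply/rowP => i; rewrite mxE.
  move/freeP: Xfree => /(_ (fun i => v 0 i)); apply; rewrite -[RHS]v0.
  by apply: eq_bigr => j _; rewrite rowK (tnth_nth 0).
apply: (mulfI D0); rewrite -det_mulmx.
pose d : 'rV[C]_6 := \row_i (if (i < 3)%N then z else z^*).
have -> : (\matrix_i tnth X i) *m hodge_mx z = \matrix_i (d 0 i *: tnth X i).
  apply/row_matrixP => i; rewrite row_mul !rowK mul_hodge_mx mxE (tnth_nth 0).
  have hp f : f \in [:: f0; f1; f2] -> hodge_h Vp z f = z *: f.
    by move=> /fV ff; rewrite -{1}[f]addr0 hodge_hE ?mem0v // scaler0 addr0.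
  have hm g : g \in [:: g0; g1; g2] -> hodge_h Vp z g = z^* *: g.
    by move=> /gV gg; rewrite -{1}[g]add0r hodge_hE ?mem0v // scaler0 add0r.
  by case: i => [[|[|[|[|[|[|//]]]]]] hi] /=; (apply: hp || apply: hm); rewrite !inE eqxx ?orbT.
rewrite det_scale_rows mulrC; congr (_ * _).
by rewrite !big_ord_recl big_ord0 !mxE /=; ring.
Qed.

End HodgeOperator.

(** * The antilinear involution $\tau$ and its commutation with $h_3$ *)

Section ConjugationOperator.
Variable C : numClosedFieldType.
Implicit Types (u v w : 'rV[C]_6) (x y : ext3 6 C^o) (z : C) (s t : triple 6).

Lemma rmorph_vol (F F' : fieldType) (f : {rmorphism F -> F'}) s t : f (vol F s t) = vol F' s t.
Proof.
rewrite /vol -det_map_mx; congr (\det _); apply/matrixP => i j.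
by rewrite !mxE rmorph_nat.
Qed.

Lemma rmorph_sig33_3 (F F' : fieldType) (f : {rmorphism F -> F'}) t :
  f (sig33_3 F t) = sig33_3 F' t.
Proof.
have fs j : f (sig33 F j) = sig33 F' j by rewrite /sig33; case: ifP; rewrite ?rmorphN rmorph1.
by rewrite !rmorphM /= !fs.
Qed.

(** Writes [x] as a combination of decomposable vectors, so that identities between sesquilinear or
    bilinear forms need only be checked on these. *)
Lemma ext3_lift_wedge3 x : ext3_lift (@wedge3 C 6) x = x.
Proof.
apply: ext3_lift_uniq => [|//|u v w]; first exact: ext3_lift_linear.
by apply: ext3_liftP; apply: (wedge3_alternating (f := id)).
Qed.

(** The coordinates are the solution of $H(\tau x,e_t)=x\wedge e_t$: each diagonal sign is its own
    inverse, and the conjugation undoes that of the first argument of $H$. *)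
Definition tau x : ext3 6 C^o := [ffun t => sig33_3 C t * \sum_s (x s)^* * vol C s t].

Lemma tau_semilinear z x y : tau (z *: x + y) = z^* *: tau x + tau y.
Proof.
apply/ffunP => t; rewrite ext3_linE !ffunE.
rewrite [z^* * _]mulrCA -mulrDr; congr (_ * _); rewrite mulr_sumr -big_split.
by apply: eq_bigr => s _; rewrite ext3_linE rmorphD rmorphM mulrDl mulrA.
Qed.

Lemma tau0 : tau 0 = 0.
Proof.
apply/ffunP => t; rewrite !ffunE big1 ?mulr0 // => s _.
by rewrite ffunE rmorph0 mul0r.
Qed.

Lemma tauZ z x : tau (z *: x) = z^* *: tau x.
Proof. by rewrite -[z *: x]addr0 tau_semilinear tau0 addr0. Qed.

Lemma tauD x y : tau (x + y) = tau x + tau y.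
Proof. by rewrite -[x]scale1r tau_semilinear conjC1 !scale1r. Qed.

Lemma tauB x y : tau (x - y) = tau x - tau y.
Proof. by rewrite -scaleN1r tauD tauZ rmorphN1 scaleN1r. Qed.

Lemma tauK : involutive tau.
Proof.
move=> x; apply/ffunP => t; rewrite ffunE.
(* The signs and [vol] are real, so the two conjugations cancel on the coordinates of [x]. *)
transitivity (\sum_r x r * \sum_s vol C r s * sig33_3 C s * vol C s t * sig33_3 C t).
  under [RHS]eq_bigr do rewrite mulr_sumr.
  rewrite exchange_big mulr_sumr; apply: eq_bigr => s _ /=.
  rewrite ffunE rmorphM (rmorph_sig33_3 Num.conj) rmorph_sum.
  move: (vol C s t) => c; rewrite mulr_sumr mulr_suml mulr_sumr.
  by apply: eq_bigr => r _; rewrite rmorphM /= conjCK (rmorph_vol Num.conj) /=; ring.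
under eq_bigr do rewrite vol_involutive.
rewrite (bigD1 t) //= eqxx mulr1 big1 ?addr0 // => r rt.
by rewrite (negPf rt) mulr0.
Qed.

Lemma hform3_tau x y : hform3 (tau x) y = pairing x y.
Proof.
rewrite /pairing exchange_big; apply: eq_bigr => t _ /=.
rewrite ffunE rmorphM (rmorph_sig33_3 Num.conj) mulrA sig33_3_sqr mul1r rmorph_sum mulr_suml.
by apply: eq_bigr => s _; rewrite rmorphM /= conjCK (rmorph_vol Num.conj) mulrAC.
Qed.

Lemma hform3_liftr x g y :
  hform3 x (ext3_lift g y) =
  \sum_t y t *
    hform3 x (g (delta_mx 0 (val t).1.1) (delta_mx 0 (val t).1.2) (delta_mx 0 (val t).2)).
Proof.
under [RHS]eq_bigr do rewrite mulr_sumr.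
rewrite exchange_big; apply: eq_bigr => r _ /=.
rewrite sum_ffunE mulr_sumr; apply: eq_bigr => t _.
by rewrite ffunE /GRing.scale /=; ring.
Qed.

Lemma hform3_lift f g x y :
  hform3 (ext3_lift f x) (ext3_lift g y) =
  \sum_s \sum_t (x s)^* * y t *
    hform3 (f (delta_mx 0 (val s).1.1) (delta_mx 0 (val s).1.2) (delta_mx 0 (val s).2))
           (g (delta_mx 0 (val t).1.1) (delta_mx 0 (val t).1.2) (delta_mx 0 (val t).2)).
Proof.
under [RHS]eq_bigr do under eq_bigr do rewrite mulr_sumr.
under [RHS]eq_bigr do rewrite exchange_big.
rewrite exchange_big; apply: eq_bigr => r _ /=.
rewrite /ext3_lift !sum_ffunE rmorph_sum -mulrA mulr_suml mulr_sumr.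
apply: eq_bigr => s _; rewrite !mulr_sumr; apply: eq_bigr => t _.
by rewrite !ffunE /GRing.scale /= rmorphM /=; ring.
Qed.

(** Reduced to [hform3_lift] through $x\wedge y=H(\tau x,y)$; the coordinates of [x] are conjugated
    once by [tau] and once more by the form. *)
Lemma pairing_lift f g x y :
  pairing (ext3_lift f x) (ext3_lift g y) =
  \sum_s \sum_t x s * y t *
    pairing (f (delta_mx 0 (val s).1.1) (delta_mx 0 (val s).1.2) (delta_mx 0 (val s).2))
            (g (delta_mx 0 (val t).1.1) (delta_mx 0 (val t).1.2) (delta_mx 0 (val t).2)).
Proof.
have cs a b : pairing (a : ext3 6 C^o) b = hform3 (tau a) b by rewrite hform3_tau.
have tl : tau (ext3_lift f x) =
    ext3_lift (fun u v w => tau (f u v w)) [ffun t => (x t)^* : C^o].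
  rewrite /ext3_lift (big_morph tau tauD tau0).
  by apply: eq_bigr => s _; rewrite tauZ ffunE.
rewrite cs tl hform3_lift; apply: eq_bigr => s _; apply: eq_bigr => t _.
by rewrite ffunE conjCK cs.
Qed.

Section Hodge.
Variable Vp : {vspace 'rV[C]_6}.
Hypotheses (dimVp : \dim Vp = 3%N) (Vpos : positive_on Vp).

Lemma hform3_hodge z x y :
  hform3 (hodge_h3 Vp z x) (hodge_h3 Vp z y) = (z * z^*) ^+ 3 * hform3 x y.
Proof.
rewrite -{2}[x]ext3_lift_wedge3 -{2}[y]ext3_lift_wedge3 !hform3_lift mulr_sumr.
apply: eq_bigr => s _; rewrite mulr_sumr; apply: eq_bigr => t _.
by rewrite !hform3_wedge /gram3 !hform_hodge //; ring.
Qed.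

(** The factor is the determinant of $h(z)$. Its agreement with the factor in [hform3_hodge] is what
    makes $\tau$ commute with $h_3(z)$. *)
Lemma pairing_hodge z x y :
  pairing (hodge_h3 Vp z x) (hodge_h3 Vp z y) = (z * z^*) ^+ 3 * pairing x y.
Proof.
rewrite -{2}[x]ext3_lift_wedge3 -{2}[y]ext3_lift_wedge3 !pairing_lift mulr_sumr.
apply: eq_bigr => s _; rewrite mulr_sumr; apply: eq_bigr => t _.
by rewrite !pairing_wedge -!mul_hodge_mx vol6_mulmx det_hodge_mx //; ring.
Qed.

(** Since $h(z)$ is onto, the basis vectors $e_t$ are among the test vectors, and $H(x,e_t)$ is up
    to sign the conjugate of a coordinate of [x]. *)
Lemma hform3_nondegenerate z x :
  z != 0 -> (forall y, hform3 x (hodge_h3 Vp z y) = 0) -> x = 0.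
Proof.
move=> z0 x0; apply/ffunP => t.
pose d : ext3 6 C^o := [ffun s => (s == t)%:R].
have : hform3 x d = 0.
  rewrite -[d]ext3_lift_wedge3 hform3_liftr big1 // => s _.
  rewrite -[X in wedge3 X](hodge_hKV Vpos _ z0) -[X in wedge3 _ X](hodge_hKV Vpos _ z0).
  by rewrite -[X in wedge3 _ _ X](hodge_hKV Vpos _ z0) -hodge_h3E x0 mulr0.
rewrite /hform3 (bigD1 t) //= big1 ?addr0 => [|s st]; last by rewrite ffunE (negPf st) mulr0.
move/(congr1 (fun c => sig33_3 C t * c)).
by rewrite !ffunE eqxx mulr1 mulrA sig33_3_sqr mul1r mulr0 => /eqP; rewrite conjC_eq0 => /eqP.
Qed.

(** For all $y$, $H(\tau h_3(z)x,h_3(z)y)=h_3(z)x\wedge h_3(z)y=|z|^6\,x\wedge y=H(h_3(z)\tau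
    x,h_3(z)y)$. *)
Lemma tau_hodge z x : z != 0 -> tau (hodge_h3 Vp z x) = hodge_h3 Vp z (tau x).
Proof.
move=> z0; apply/eqP; rewrite -subr_eq0; apply/eqP.
apply: (hform3_nondegenerate z0) => y.
have hB a b : hform3 (a - b) (hodge_h3 Vp z y) =
    hform3 a (hodge_h3 Vp z y) - hform3 b (hodge_h3 Vp z y).
  rewrite /hform3 -sumrB; apply: eq_bigr => t _.
  by rewrite !ffunE rmorphB /=; ring.
by rewrite hB hform3_tau hform3_hodge pairing_hodge hform3_tau subrr.
Qed.

End Hodge.
End ConjugationOperator.

(** * The decomposition of the exterior cube into the $W^{p,q}$ *)

Section HodgePieces.
Variables (C : numClosedFieldType) (Vp : {vspace 'rV[C]_6}).
Hypotheses (dimVp : \dim Vp = 3%N) (Vpos : positive_on Vp).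
Implicit Types (u v w : 'rV[C]_6) (x y : ext3 6 C^o) (z : C) (p q : int) (s : seq int).

Local Notation piece p := (hodge_piece Vp p (3 - p)).

Lemma hodge_char_sep p q : p != q ->
  exists2 z, z != 0 & z ^ p * z^* ^ (3 - p) != z ^ q * z^* ^ (3 - q) :> C.
Proof.
move=> pq; pose n := `|p - q|%N; have n0 : (0 < n)%N by rewrite absz_gt0 subr_eq0.
(* On the unit circle the character is $z^{2p-3}$, so the two characters differ by the factor
   $z^{2(p-q)}$, which this root makes equal to $-1$. *)
pose z : C := (2 * n).-root (-1).
have zn : z ^+ (2 * n) = -1 by rewrite rootCK // muln_gt0.
have z0 : z != 0.
  apply/eqP => z0; move/eqP: zn; rewrite z0 expr0n muln_eq0 /= eqn0Ngt n0 /=.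
  by rewrite eq_sym oppr_eq0 oner_eq0.
have normz : `|z| = 1.
  apply/eqP; rewrite -(@pexpr_eq1 _ _ (2 * n)) ?muln_gt0 // -normrX zn normrN1 //.
have zc : z^* = z^-1 by rewrite invC_norm normz expr1n invr1 mul1r.
have zE m : z ^ m * z^* ^ (3 - m) = z ^ (2 * m - 3).
  by rewrite zc exprz_inv -expfzDr //; congr (_ ^ _); lia.
exists z => //; rewrite !zE; apply/eqP => e.
have n1 : z ^+ (2 * n) = 1.
  have e' : z ^ (2 * (p - q)) = 1.
    rewrite (_ : 2 * (p - q) = (2 * p - 3) - (2 * q - 3)); last by lia.
    by rewrite expfzDr // e -expfzDr // subrr expr0z.
  rewrite exprnP PoszM /n; case: (lerP 0 (p - q)) => pq0; first by rewrite gez0_abs.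
  by rewrite ltz0_abs // mulrN -invr_expz e' invr1.
by move/eqP: zn; rewrite n1 -subr_eq0 opprK -mulr2n pnatr_eq0.
Qed.

Lemma hodge_h3_linear z : linear (hodge_h3 Vp z).
Proof. exact: ext3_lift_linear. Qed.

Lemma hodge_h3_sum s z x :
  z != 0 -> x \in (\sum_(q <- s) piece q)%VS -> hodge_h3 Vp z x \in (\sum_(q <- s) piece q)%VS.
Proof.
move=> z0; elim: s x => [|q s IH] x.
  rewrite big_nil !memv0 => /eqP->.
  by have := hodge_h3_linear z (-1) 0 0; rewrite scaler0 addr0 scaleN1r addNr => ->.
rewrite !big_cons => /memv_addP[a aq [b bs ->]].
have := hodge_h3_linear z 1 a b; rewrite !scale1r => ->.
by apply: memv_add (IH _ bs); have /mem_hodge_piece -> := aq; rewrite ?memvZ.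
Qed.

(* Applying h3(z) - z^q zbar^(3-q) for a separating z removes the summand q. *)
Lemma hodge_piece_indep p s :
  p \notin s -> (piece p :&: \sum_(q <- s) piece q = 0)%VS.
Proof.
move=> ps; apply/eqP; rewrite -subv0; apply/subvP => x; rewrite memv_cap memv0 => /andP[xp].
elim: s ps => [|q s IH]; first by rewrite big_nil memv0.
rewrite inE negb_or big_cons => /andP[pq ps] /memv_addP[a aq [b bs xE]].
apply: IH => //; have [z z0] := hodge_char_sep pq; rewrite -subr_eq0 => zpq.
rewrite -[x]scale1r -(mulVf zpq) -scalerA memvZ // scalerBl.
have /mem_hodge_piece/(_ z z0) <- := xp; rewrite xE.
have := hodge_h3_linear z 1 a b; rewrite !scale1r => ->.
have /mem_hodge_piece/(_ z z0) -> := aq; rewrite scalerDr opprD addrACA subrr add0r.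
by rewrite memvB ?memvZ ?hodge_h3_sum.
Qed.

(** Splitting each factor of $u\wedge v\wedge w$ along $V_+\oplus V_-$ gives eight terms; a term
    with $p$ factors in $V_+$ lies in $W^{p,3-p}$. *)
Lemma hodge_piece_full : (\sum_(p <- [:: 0; 1; 2; 3]%R) piece p)%VS = fullv.
Proof.
apply/eqP; rewrite eqEsubv subvf; apply/subvP => x _.
set S := (X in _ \in X).
have Spiece p y : p \in [:: 0; 1; 2; 3] -> y \in piece p -> y \in S.
  move=> ps; apply: (subvP _); rewrite /S (big_rem p ps) /=; exact: addvSl.
have hV z a : a \in Vp -> hodge_h Vp z a = z *: a.
  by move=> aV; rewrite -{1}[a]addr0 hodge_hE ?mem0v // scaler0 addr0.
have hV' z b : b \in Vminus Vp -> hodge_h Vp z b = z^* *: b.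
  by move=> bV; rewrite -{1}[b]add0r hodge_hE ?mem0v // scaler0 add0r.
have [l1 l2 l3 _] := wedge3_alternating (f := @id 'rV[C]_6) (fun _ _ _ => erefl).
have wD1 a b v w : wedge3 (a + b) v w = wedge3 a v w + wedge3 b v w.
  by have := l1 v w 1 a b; rewrite !scale1r.
have wD2 u a b w : wedge3 u (a + b) w = wedge3 u a w + wedge3 u b w.
  by have := l2 u w 1 a b; rewrite !scale1r.
have wD3 u v a b : wedge3 u v (a + b) = wedge3 u v a + wedge3 u v b.
  by have := l3 u v 1 a b; rewrite !scale1r.
have wZ (a b c : C) u v w : wedge3 (a *: u) (b *: v) (c *: w) = (a * b * c) *: wedge3 u v w.
  by apply/ffunP => t; rewrite [RHS]ffunE !wedge3E !mxE /GRing.scale /=; ring.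
have wS u v w : wedge3 u v w \in S.
  have [a [b [aV bV ->]]] := Vplus_Vminus_split Vpos u.
  have [a' [b' [aV' bV' ->]]] := Vplus_Vminus_split Vpos v.
  have [a'' [b'' [aV'' bV'' ->]]] := Vplus_Vminus_split Vpos w.
  rewrite wD1 !wD2 !wD3.
  have pS p : p \in [:: 0; 1; 2; 3] -> forall c1 c2 c3 : C -> C,
      (forall z, c1 z * c2 z * c3 z = z ^ p * z^* ^ (3 - p)) -> forall u v w,
      (forall z, hodge_h Vp z u = c1 z *: u) -> (forall z, hodge_h Vp z v = c2 z *: v) ->
      (forall z, hodge_h Vp z w = c3 z *: w) -> wedge3 u v w \in S.
    move=> ps c1 c2 c3 cE u1 v1 w1 hu hv hw; apply: Spiece ps _; apply/mem_hodge_piece => z z0.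
    by rewrite hodge_h3E hu hv hw wZ cE.
  (* The boolean records whether a factor lies in $V_+$, so $p$ is the sum of the three booleans. *)
  pose k (e : bool) z := if e then z else z^*.
  have kS (e1 e2 e3 : bool) u1 v1 w1 :
      (forall z, hodge_h Vp z u1 = k e1 z *: u1) -> (forall z, hodge_h Vp z v1 = k e2 z *: v1) ->
      (forall z, hodge_h Vp z w1 = k e3 z *: w1) -> wedge3 u1 v1 w1 \in S.
    apply: (pS (e1 + e2 + e3)%N); first by case: e1; case: e2; case: e3.
    by move=> z; case: e1; case: e2; case: e3; rewrite /k /= -?exprnP; ring.
  by do ![apply: memvD];
    [apply: (kS true true true)|apply: (kS true true false)|apply: (kS true false true)
    |apply: (kS true false false)|apply: (kS false true true)|apply: (kS false true false)
    |apply: (kS false false true)|apply: (kS false false false)] => z;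
    first [exact: hV | exact: hV'].
rewrite -[x]ext3_lift_wedge3; apply: memv_suml => t _; exact: memvZ.
Qed.

Lemma tau_hodge_piece p q x : x \in hodge_piece Vp p q -> tau x \in hodge_piece Vp q p.
Proof.
move/mem_hodge_piece => xpq; apply/mem_hodge_piece => z z0.
rewrite -tau_hodge // xpq // tauZ rmorphM mulrC.
by congr (_ * _ *: _); rewrite rmorphXz ?unitfE ?conjC_eq0 //= conjCK.
Qed.

End HodgePieces.

(** * The rational form $W_+$, its dimension and its complexification *)

Section RationalStructure.
Variables (C : numClosedFieldType) (K : fieldExtType rat) (omega : K).
Hypotheses (omega_prim : 3.-primitive_root omega) (K_gen : (<<1; omega>> = fullv)%VS).
Variable iota : {rmorphism K -> C}.
Implicit Types (w : ext3 6 K).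

Local Notation embed := (@ext3_embed _ _ iota 6).

Lemma omega_sum : omega ^+ 2 + omega + 1 = 0.
Proof.
have o1 : omega - 1 != 0.
  by rewrite subr_eq0 -[omega]expr1 -[X in _ != X](expr0 omega) (eq_prim_root_expr omega_prim).
apply: (mulfI o1); rewrite mulr0 -[RHS](subrr 1) -{3}(prim_expr_order omega_prim).
by ring.
Qed.

(** The minimal polynomial of [omega] over the rationals divides $X^2+X+1$. *)
Lemma dim_K_le2 : (\dim {:K} <= 2)%N.
Proof.
rewrite -K_gen dim_Fadjoin dimv1 muln1 -ltnS -size_minPoly.
pose p : {poly K} := 'X^2 + 'X + 1.
have sp : size p = 3%N.
  rewrite /p -addrA size_polyDl ?size_polyXn // -[1]/(1%:P : {poly K}) -[_ + 1%:P]/('X + 1%:P).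
  by rewrite size_XaddC.
rewrite -sp dvdp_leq -?size_poly_gt0 ?sp //; apply: minPoly_dvdp.
  by rewrite !rpredD ?rpredX ?polyOverX ?rpred1.
by rewrite /root !hornerE omega_sum.
Qed.

Lemma iota_rat (a : rat) : iota a%:A = ratr a.
Proof. exact: (fmorph_eq_rat (iota \o in_alg K)). Qed.

Lemma iota_omega_conj : (iota omega)^* = iota (omega ^+ 2).
Proof.
have o3 : iota omega ^+ 3 = 1 by rewrite -rmorphXn /= (prim_expr_order omega_prim) rmorph1.
have o0 : iota omega != 0 by apply: contra_eq_neq o3 => ->; rewrite expr0n eq_sym oner_eq0.
have n1 : `|iota omega| = 1.
  by apply/eqP; rewrite -(@pexpr_eq1 _ _ 3) // -normrX o3 normr1.
apply: (mulfI o0); rewrite -normCK n1 expr1n -rmorphM -exprS.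
by rewrite (prim_expr_order omega_prim) rmorph1.
Qed.

(** Write [k] as a rational polynomial in [omega]: conjugation fixes its coefficients and replaces
    [omega] by its square. *)
Lemma iota_conj k : exists k', iota k' = (iota k)^*.
Proof.
pose p := Fadjoin_poly 1 omega k; exists p.[omega ^+ 2].
have kE : p.[omega] = k by apply: Fadjoin_poly_eq; rewrite K_gen memvf.
rewrite -[in RHS]kE -!(horner_map iota) -(horner_map Num.conj) /= -iota_omega_conj; congr (_.[_]).
apply/polyP => i; rewrite !coef_map /=.
have /vlineP[a ->] : p`_i \in 1%VS by apply/polyOverP; apply: Fadjoin_polyOver.
by rewrite iota_rat fmorph_rat.
Qed.

Lemma ext3_embed_semilinear (a : rat) v w : embed (a *: v + w) = ratr a *: embed v + embed w.
Proof.
apply/ffunP => t; rewrite ext3_linE !ffunE rmorphD; congr (_ + _).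
by rewrite -iota_rat -rmorphM mulr_algl.
Qed.

Lemma ext3_embed_inj : injective embed.
Proof.
move=> v w e; apply/ffunP => t; apply: (fmorph_inj iota).
by have := congr1 (fun f : ext3 6 C^o => f t) e; rewrite !ffunE.
Qed.

(** The $\mathbb{K}$-vector space structure of $W$; the scaling [*:] on [ext3 6 K] is by rationals
    only. *)
Definition kscale (k : K) w : ext3 6 K := [ffun t => k * w t].

Lemma ext3_embed_kscale k w : embed (kscale k w) = iota k *: embed w.
Proof. by apply/ffunP => t; rewrite !ffunE rmorphM. Qed.

Lemma kscale_linear k : linear (kscale k).
Proof. by move=> a v w; apply/ffunP => t; rewrite !ffunE mulrDr scalerAr. Qed.

Lemma tau_ext3_embed w : exists w', embed w' = tau (embed w).
Proof.
have [c cE] := choice iota_conj.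
exists [ffun t => sig33_3 K t * \sum_s c (w s) * vol K s t]; apply/ffunP => t.
rewrite !ffunE rmorphM rmorph_sum (rmorph_sig33_3 iota); congr (_ * _).
by apply: eq_bigr => s _; rewrite rmorphM /= (rmorph_vol iota) cE ffunE.
Qed.

(** A square root of $-3$. *)
Definition theta : K := omega - omega ^+ 2.

Lemma theta_neq0 : theta != 0.
Proof.
by rewrite subr_eq0 -[X in X != _]expr1 (eq_prim_root_expr omega_prim).
Qed.

Lemma iota_theta_conj : (iota theta)^* = - iota theta.
Proof.
rewrite /theta !rmorphB /= rmorphXn rmorphXn /= iota_omega_conj -rmorphXn -exprM.
rewrite -[(2 * 2)%N]/(3 + 1)%N exprD (prim_expr_order omega_prim) mul1r expr1 opprB.
by rewrite rmorphXn.
Qed.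

Definition Wplus : {vspace ext3 6 K} := vspace_of (fun w => tau (embed w) = embed w).

(** Conjugation fixes the rationals, so the fixed vectors of the antilinear [tau] form a rational
    subspace and [vspace_of] does not fall back on its default value. *)
Lemma mem_Wplus w : w \in Wplus <-> tau (embed w) = embed w.
Proof.
apply: mem_vspace_of => [|a u v hu hv].
  have -> : embed 0 = 0 by apply/ffunP => t; rewrite !ffunE rmorph0.
  exact: tau0.
by rewrite ext3_embed_semilinear tau_semilinear fmorph_rat hu hv.
Qed.

Local Notation phi := (complexified_inclusion iota Wplus).

Lemma embed_Wplus_limg w : w \in Wplus -> embed w \in limg phi.
Proof.
move=> wW; rewrite -[embed w]scale1r -(vsprojK wW) -complexified_inclusionE.
exact: memv_img (memvf _).
Qed.

(** $W$ spans over $\mathbb{C}$, and for $w\in W$ one has $2w=(w+\tau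
    w)+\theta^{-1}\cdot\theta(w-\tau w)$, where $w+\tau w$ and $\theta(w-\tau w)$ lie in $W_+$. *)
Lemma limg_complexified_inclusion : limg phi = fullv.
Proof.
have two0 : 2 != 0 :> C by rewrite pnatr_eq0.
have it0 : iota theta != 0 by rewrite fmorph_eq0 theta_neq0.
have eD v w : embed (v + w) = embed v + embed w.
  by rewrite -[v]scale1r ext3_embed_semilinear rmorph1 !scale1r.
have eB v w : embed (v - w) = embed v - embed w.
  by apply/ffunP => t; rewrite !ffunE rmorphB.
have embed_limg w : embed w \in limg phi.
  have [w' w'E] := tau_ext3_embed w.
  have w1 : w + w' \in Wplus.
    by apply/mem_Wplus; rewrite eD w'E tauD tauK addrC.
  have w2 : kscale theta (w - w') \in Wplus.
    apply/mem_Wplus; rewrite ext3_embed_kscale eB w'E tauZ tauB tauK.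
    by rewrite iota_theta_conj scaleNr -scalerN opprB.
  have -> : embed w = 2^-1 *: (embed (w + w') + (iota theta)^-1 *: embed (kscale theta (w - w'))).
    rewrite ext3_embed_kscale scalerA mulVf // scale1r eD eB addrACA subrr addr0.
    by rewrite -mulr2n -scaler_nat scalerA mulVf // scale1r.
  by rewrite memvZ // memvD ?memvZ ?embed_Wplus_limg.
apply/eqP; rewrite eqEsubv subvf; apply/subvP => x _.
have -> : x = \sum_t x t *: embed [ffun s => (s == t)%:R].
  apply/ffunP => s; rewrite sum_ffunE (bigD1 s) //= big1 ?addr0 => [|t ts].
    by rewrite !ffunE eqxx rmorph1 /GRing.scale /= mulr1.
  by rewrite !ffunE eq_sym (negPf ts) rmorph0 scaler0.
by apply: memv_suml => t _; rewrite memvZ.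
Qed.

(* theta is purely imaginary, so theta W_+ is the (-1)-eigenspace of tau on W. *)
Lemma dim_Wplus_le : (\dim Wplus <= 20)%N.
Proof.
pose m : {linear ext3 6 K -> ext3 6 K} :=
  HB.pack (kscale theta) (GRing.isLinear.Build _ _ _ _ _ (kscale_linear theta)).
have mE w : linfun m w = kscale theta w by rewrite lfunE.
have embed_m w : embed (linfun m w) = iota theta *: embed w by rewrite mE ext3_embed_kscale.
have dm : \dim (linfun m @: Wplus) = \dim Wplus.
  apply: limg_dim_eq; apply/eqP; rewrite -subv0; apply/subvP => w.
  rewrite memv_cap memv_ker memv0 => /andP[_ /eqP w0]; apply/eqP/ffunP => t.
  have := congr1 (fun f : ext3 6 K => f t) w0; rewrite mE !ffunE => /eqP.
  by rewrite mulf_eq0 (negPf theta_neq0) => /eqP.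
have d0 : (Wplus :&: linfun m @: Wplus = 0)%VS.
  apply/eqP; rewrite -subv0; apply/subvP => w; rewrite memv_cap memv0.
  move=> /andP[/mem_Wplus ww /memv_imgP[v /mem_Wplus vW wE]].
  have : embed w = - embed w.
    by rewrite -{1}ww wE embed_m tauZ vW iota_theta_conj scaleNr.
  move=> /eqP; rewrite -subr_eq0 opprK -mulr2n -scaler_nat scaler_eq0 pnatr_eq0 /= => /eqP e0.
  apply/eqP/ext3_embed_inj; rewrite e0; apply/ffunP => t; by rewrite !ffunE rmorph0.
have := dimvS (subvf (Wplus + linfun m @: Wplus)).
rewrite dimv_disjoint_sum // dm dimvf /dim /= card_triple -[dim _]dimvf addnn => le.
by have := leq_trans le (leq_mul (leqnn 20) dim_K_le2); rewrite -muln2 leq_pmul2r.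
Qed.

Lemma dim_cplx_Wplus : \dim {: cplx C (subvs_of Wplus)} = \dim Wplus.
Proof. by rewrite dimvf /dim /= mul1n dimvf. Qed.

Lemma dim_ext3 : \dim {: ext3 6 C^o} = 20%N.
Proof. by rewrite dimvf /dim /= card_triple /dim /= muln1. Qed.

(** The lower bound comes from surjectivity: $W_+\otimes\mathbb{C}$, of complex dimension
    $\dim_{\mathbb{Q}}W_+$, maps onto a space of dimension 20. *)
Lemma dim_Wplus : \dim Wplus = 20%N.
Proof.
apply/eqP; rewrite eqn_leq dim_Wplus_le -[leqRHS]dim_cplx_Wplus -(limg_ker_dim phi).
by rewrite limg_complexified_inclusion dim_ext3 leq_addl.
Qed.

Lemma lker_complexified_inclusion : lker phi == 0%VS.
Proof.
have := limg_ker_dim phi fullv; rewrite dim_cplx_Wplus dim_Wplus capfv.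
by rewrite limg_complexified_inclusion dim_ext3 -[RHS]add0n => /addIn/eqP; rewrite dimv_eq0.
Qed.

Lemma complexified_inclusion_bij : bijective phi.
Proof.
exists (phi^-1)%VF; first exact: lker0_lfunK lker_complexified_inclusion.
by move=> x; apply: limg_lfunVK; rewrite limg_complexified_inclusion memvf.
Qed.

(** Both sides are antilinear in [x] and agree on the vectors $w\otimes 1$, because [tau] fixes
    $W_+$. *)
Lemma tau_complexified_inclusion x : tau (phi x) = phi (cplx_conj x).
Proof.
rewrite {1}[x]cplx_gen linear_sum (big_morph _ (@tauD C) (@tau0 C)).
have -> : cplx_conj x =
    \sum_(i < \dim {:subvs_of Wplus}) ctensor (vbasis {:subvs_of Wplus})`_i (x 0 i)^*.
  by rewrite [LHS]cplx_gen; apply: eq_bigr => i _; rewrite mxE.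
rewrite linear_sum; apply: eq_bigr => i _; rewrite /= !complexified_inclusionE tauZ.
by congr (_ *: _); apply/mem_Wplus; apply: subvsP.
Qed.

End RationalStructure.

(** * Transport of the decomposition to $W_+\otimes\mathbb{C}$ *)

Lemma dim_sum_indep (F : fieldType) (V : vectType F) (I : eqType) (s : seq I)
    (U : I -> {vspace V}) :
  uniq s -> (forall p r, p \notin r -> (U p :&: \sum_(q <- r) U q = 0)%VS) ->
  \dim (\sum_(p <- s) U p) = (\sum_(p <- s) \dim (U p))%N.
Proof.
move=> us ind; elim: s us => [|p s IH]; first by rewrite !big_nil dimv0.
by rewrite !big_cons => /andP[ps us]; rewrite dimv_disjoint_sum ?ind ?IH.
Qed.

Theorem proposition3p1 (R : realType) (K : fieldExtType rat) (omega : K)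
    (omega_prim : 3.-primitive_root omega)
    (K_gen : (<<1; omega>> = fullv)%VS)
    (iota : {rmorphism K -> R[i]})
    (Vp : {vspace 'rV[R[i]]_6})
    (dimVp : \dim Vp = 3%N) (Vp_pos : positive_on Vp) :
  exists Wp : {vspace ext3 6 K},
    [/\ \dim Wp = 20%N,
        bijective (complexified_inclusion iota Wp)
      & rational_hodge_structure 3
          (fun p q => (complexified_inclusion iota Wp @^-1: hodge_piece Vp p q)%VS)].
Proof.
exists (Wplus iota).
have phi_bij := complexified_inclusion_bij omega_prim K_gen iota.
have limg_phi := limg_complexified_inclusion omega_prim K_gen iota.
split; [exact: dim_Wplus omega_prim K_gen iota|exact: phi_bij|].
set phi := complexified_inclusion iota (Wplus iota) in phi_bij limg_phi *.
have phi_inj : injective phi := bij_inj phi_bij.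
pose A (p : int) := hodge_piece Vp p (3 - p); pose V p := (phi @^-1: A p)%VS.
have phiV p : (phi @: V p = A p)%VS by rewrite lpreimK // limg_phi subvf.
(* Independence and, below, spanning are pulled back along the bijection [phi]. *)
have Vind p s : p \notin s -> (V p :&: \sum_(q <- s) V q = 0)%VS.
  move=> ps; apply/eqP; rewrite -subv0; apply/subvP => x.
  rewrite memv_cap memv0 -memv_preim => /andP[xp /(memv_img phi)].
  rewrite limg_sum; under eq_bigr do rewrite phiV; move=> xs.
  have : phi x \in (A p :&: \sum_(q <- s) A q)%VS by rewrite memv_cap xp.
  rewrite hodge_piece_indep // memv0 => /eqP x0.
  by apply/eqP/phi_inj; rewrite x0 linear0.
have Vfull : (\sum_(p <- [:: 0; 1; 2; 3]%R) V p)%VS = fullv.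
  apply/eqP; rewrite eqEsubv subvf; apply/subvP => x _.
  have : phi x \in (phi @: \sum_(p <- [:: 0; 1; 2; 3]%R) V p)%VS.
    rewrite limg_sum; under eq_bigr do rewrite phiV.
    by rewrite hodge_piece_full ?memvf.
  by case/memv_imgP => y yV /phi_inj ->.
split.
  exists [:: 0; 1; 2; 3]; split=> //.
  (* A piece outside the list meets the sum of the listed ones trivially, and that sum is the whole
     space. *)
  - by move=> p /Vind; rewrite Vfull capvf.
  - by rewrite directvE /=; apply/eqP; apply: dim_sum_indep.
(* Under [phi] the conjugation becomes [tau], which exchanges the two indices. *)
have conj_sub p q x : x \in (phi @^-1: hodge_piece Vp p q)%VS ->
    cplx_conj x \in (phi @^-1: hodge_piece Vp q p)%VS.
  rewrite -!memv_preim => /(tau_hodge_piece dimVp Vp_pos).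
  by rewrite /phi tau_complexified_inclusion.
move=> p q _; apply/seteqP; split=> [_ [x xV <-]|x xV] /=; first exact: conj_sub.
(* Conjugation is an involution, so the inclusion with [p] and [q] exchanged gives the reverse
   one. *)
exists (cplx_conj x); first exact: conj_sub.
by apply/rowP => i; rewrite !mxE conjCK.
Qed.
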